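(* Let $G$ be a simple, finite, connected graph and $\{F_1,\ldots,F_k\}$ a c-partition of $E(G)$; let $G_i=G/F_i$. Define $w_i(X)=|V(X)|$ and $\lambda_i(X)=|E(X)|$ for each vertex $X$ of $G_i$ (a connected component of $G\setminus F_i$), and $\lambda_i'(E)=|\widehat{E}|$, $w_i'(E)=\sum_{xy\in\widehat{E}}\deg(x)\deg(y)$ for each edge $E$ of $G_i$. Then $$wSz^*(G)=\sum_{i=1}^kSz(G_i,w_i,w_i'),\quad wPI_v^*(G)=\sum_{i=1}^kPI_v(G_i,w_i,w_i'),$$ $$wSz_e^*(G)=\sum_{i=1}^kSz_t(G_i,\lambda_i,\lambda_i',w_i'),\quad wPI^*(G)=\sum_{i=1}^k\big(PI_v(G_i,\lambda_i,w_i')+PI(G_i,\lambda_i',w_i')\big).$$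
   Context: $d$ is shortest-path distance; for vertex $u$ and edge $f=xy$, $d(u,f)=\min\{d(u,x),d(u,y)\}$. For an edge $e=uv$: $n_u(e)$ = number of vertices strictly closer to $u$ than to $v$, $m_u(e)$ = number of edges $f$ with $d(u,f)<d(v,f)$. $wSz^*(G)=\sum_{e=uv}\deg(u)\deg(v)n_u(e)n_v(e)$, $wPI_v^*(G)=\sum_{e=uv}\deg(u)\deg(v)(n_u(e)+n_v(e))$, $wSz_e^*(G)=\sum_{e=uv}\deg(u)\deg(v)m_u(e)m_v(e)$, $wPI^*(G)=\sum_{e=uv}\deg(u)\deg(v)(m_u(e)+m_v(e))$. For a graph $H$ with vertex-weight $w$ and edge-weights $\lambda',w'$: $n_u(e|(H,w))=\sum_{x:d(u,x)<d(v,x)}w(x)$, $m_u(e|(H,\lambda'))=\sum_{f:d(u,f)<d(v,f)}\lambda'(f)$; $Sz(H,w,w')=\sum_{e=uv}w'(e)n_u(e|(H,w))n_v(e|(H,w))$; $PI_v(H,w,w')=\sum_{e=uv}w'(e)(n_u(e|(H,w))+n_v(e|(H,w)))$; $PI(H,\lambda',w')=\sum_{e=uv}w'(e)(m_u(e|(H,\lambda'))+m_v(e|(H,\lambda')))$; $Sz_t(H,w,\lambda',w')=\sum_{e=uv}w'(e)(n_u(e|(H,w))+m_u(e|(H,\lambda')))(n_v(e|(H,w))+m_v(e|(H,\lambda')))$. Djoković–Winkler relation $\Theta$: $u_1v_1\,\Theta\,u_2v_2$ iff $d(u_1,u_2)+d(v_1,v_2)\neq d(u_1,v_2)+d(u_2,v_1)$;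 $\Theta^*$ its transitive closure; a c-partition is a partition of $E(G)$ each of whose parts is a union of $\Theta^*$-classes. $G/F$: vertices are the components of $G\setminus F$ (edges of $F$ deleted), two adjacent if some vertex of one is adjacent in $G$ to a vertex of the other; for an edge $E=XY$ of $G/F$, $\widehat{E}$ is the set of edges of $G$ joining $X$ and $Y$. *)

(* Defs.v *)
From mathcomp Require Import all_boot.

Set Implicit Arguments.
Unset Strict Implicit.
Unset Printing Implicit Defensive.

Record sgraph := SGraph {
  vertex :> finType;
  adj : rel vertex;
  adj_sym : symmetric adj;
  adj_irr : irreflexive adj }.

Section Graph.
Variable G : sgraph.
Implicit Types (x y u v : G) (e f g : {set G}) (F : {set {set G}}).

Definition connected : bool :=
  (0 < #|G|) && [forall x : G, forall y : G, connect (@adj G) x y].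

(* An edge xy is the unordered pair [set x; y]. *)
Definition edges : {set {set G}} :=
  [set f | [exists x, exists y, adj x y && (f == [set x; y])]].

Definition deg x : nat := #|[set y | adj x y]|.

(* Least length of a walk from x to y. In a connected graph every distance is
   less than #|G|; the value #|G| occurs only when y is unreachable from x. *)
Definition dist x y : nat :=
  \big[minn/#|G|]_(n < #|G| | [exists p : n.-tuple G,
     path (@adj G) x p && (last x p == y)]) n.

(* dist u x <= #|G| always, so the default value #|G| is harmless. *)
Definition dist_edge u f : nat := \big[minn/#|G|]_(x in f) dist u x.

(* In the next two definitions e is meant to be an edge uv, so that
   e :\ u = [set v]. *)
Definition closer_vertices u e : {set G} :=
  [set x | [forall v in e :\ u, dist u x < dist v x]].

Definition closer_edges u e : {set {set G}} :=
  [set f in edges | [forall v in e :\ u, dist_edge u f < dist_edge v f]].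

(* For an edge e = uv, a product (resp. a sum) over the endpoints,
   \prod_(u in e) a u (resp. \sum_(u in e) a u), is a u * a v (resp.
   a u + a v). *)
Definition deg_edge e : nat := \prod_(u in e) deg u.

Definition n_ u e : nat := #|closer_vertices u e|.
Definition m_ u e : nat := #|closer_edges u e|.

Definition wSz_star : nat :=
  \sum_(e in edges) deg_edge e * \prod_(u in e) n_ u e.
Definition wPIv_star : nat :=
  \sum_(e in edges) deg_edge e * \sum_(u in e) n_ u e.
Definition wSze_star : nat :=
  \sum_(e in edges) deg_edge e * \prod_(u in e) m_ u e.
Definition wPI_star : nat :=
  \sum_(e in edges) deg_edge e * \sum_(u in e) m_ u e.

(* Weighted versions. Edge weights are functions on all of {set G}; only
   their values on edges are used. *)
Definition n_wt (w : G -> nat) u e : nat :=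
  \sum_(x in closer_vertices u e) w x.
Definition m_wt (lam' : {set G} -> nat) u e : nat :=
  \sum_(f in closer_edges u e) lam' f.

Definition Sz (w : G -> nat) (w' : {set G} -> nat) : nat :=
  \sum_(e in edges) w' e * \prod_(u in e) n_wt w u e.
Definition PIv (w : G -> nat) (w' : {set G} -> nat) : nat :=
  \sum_(e in edges) w' e * \sum_(u in e) n_wt w u e.
Definition PI (lam' w' : {set G} -> nat) : nat :=
  \sum_(e in edges) w' e * \sum_(u in e) m_wt lam' u e.
Definition Szt (w : G -> nat) (lam' w' : {set G} -> nat) : nat :=
  \sum_(e in edges) w' e * \prod_(u in e) (n_wt w u e + m_wt lam' u e).

(* Djokovic-Winkler relation. Exchanging the endpoints of f or of g swaps the
   two sides of the inequation, so the choice of u1, v1, u2, v2 does not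
   matter. *)
Definition Theta : rel {set G} := fun f g =>
  [&& f \in edges, g \in edges &
    [exists u1, exists v1, exists u2, exists v2,
      [&& f == [set u1; v1], g == [set u2; v2] &
          dist u1 u2 + dist v1 v2 != dist u1 v2 + dist u2 v1]]].

(* [connect] is the reflexive transitive closure; Theta is already reflexive
   on edges, so there it is the transitive closure. *)
Definition Theta_classes : {set {set {set G}}} :=
  equivalence_partition (connect Theta) edges.

Definition c_partition (P : {set {set {set G}}}) : bool :=
  partition P edges &&
  [forall F in P, exists C : {set {set {set G}}},
     (C \subset Theta_classes) && (F == cover C)].

Section Quotient.
Variable F : {set {set G}}.

Definition del_adj : rel G := fun x y => adj x y && ([set x; y] \notin F).

Definition components : {set {set G}} :=
  equivalence_partition (connect del_adj) [set: G].

Definition quot_vertex : finType := {X : {set G} | X \in components}.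

Definition quot_adj : rel quot_vertex := fun X Y =>
  (X != Y) && [exists x in val X, exists y in val Y, adj x y].

Lemma quot_adj_sym : symmetric quot_adj.
Proof.
suff imp X Y : quot_adj X Y -> quot_adj Y X by move=> X Y; apply/idP/idP; apply: imp.
case/andP=> XY /exists_inP[x xX] /exists_inP[y yY] xy.
rewrite /quot_adj eq_sym XY; apply/exists_inP; exists y => //.
by apply/exists_inP; exists x => //; rewrite adj_sym.
Qed.

Lemma quot_adj_irr : irreflexive quot_adj.
Proof. by move=> X; rewrite /quot_adj eqxx. Qed.

Definition quot : sgraph := SGraph quot_adj_sym quot_adj_irr.

Definition quot_hat (E : {set quot}) : {set {set G}} :=
  [set f | [exists X : quot, exists Y : quot,
     (E == [set X; Y]) &&
     [exists x in val X, exists y in val Y, adj x y && (f == [set x; y])]]].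

Definition quot_w (X : quot) : nat := #|val X|.

(* Number of edges of the component X of G \ F. *)
Definition quot_lam (X : quot) : nat :=
  #|[set f in edges :\: F | f \subset val X]|.

Definition quot_lam' (E : {set quot}) : nat := #|quot_hat E|.

Definition quot_w' (E : {set quot}) : nat :=
  \sum_(f in quot_hat E) deg_edge f.

End Quotient.
End Graph.

(* Main.v *)
(* Let F be a union of Theta*-classes. For an edge ab, the function
   d(z,a) - d(z,b) of z changes only along edges in relation Theta with ab.
   Summing these functions over the F-edges of a geodesic from x to y gives a
   potential that rises by twice the number of these edges from x to y, while
   it rises by at most 2 along an edge of F and is constant along the other
   edges: so a geodesic minimises the number of F-edges among all walks with
   the same ends. This minimum is the distance in G/F, and since the complement
   of F is also closed under Theta, d(x,y) is the sum of the distances in G/F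
   and in G/(E \ F). The ends of an edge uv of F coincide in G/(E \ F), so
   d(u,x) - d(v,x) can be read off G/F; the four identities follow by grouping
   the vertices and edges of G by their images in G/F. *)

Require Import Defs.
From mathcomp Require Import all_boot all_order all_algebra zify.

Set Implicit Arguments.
Unset Strict Implicit.
Unset Printing Implicit Defensive.

(** * Minima of finite families and distances in a graph *)

Lemma leq_bigminn (I : finType) (P : pred I) (a : I -> nat) (d m : nat) :
  (m <= \big[minn/d]_(i | P i) a i) = (m <= d) && [forall (i | P i), m <= a i].
Proof.
have [md|dm] /= := boolP (m <= d).
  apply/idP/forall_inP => [h i Pi|h]; last first.
    by elim/big_ind: _ => // x y mx my; rewrite leq_min mx.
  apply: leq_trans h _; rewrite -big_filter.
  have: i \in [seq i <- index_enum I | P i] by rewrite mem_filter Pi mem_index_enum.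
  elim: (filter _ _) => // j s IH; rewrite inE big_cons => /predU1P[<-|/IH h].
    exact: geq_minl.
  by rewrite (leq_trans (geq_minr _ _)).
apply: contraNF dm => h; apply: leq_trans h _.
rewrite -big_filter; elim: (filter _ _) => [|j s IH]; rewrite ?big_nil // big_cons.
by rewrite (leq_trans (geq_minr _ _)).
Qed.

Section Distance.
Variable G : sgraph.
Implicit Types (x y z u v : G) (p q : seq G).

Lemma dist_le_card x y : dist x y <= #|G|.
Proof. by have := leqnn (dist x y); rewrite {2}/dist leq_bigminn => /andP[]. Qed.

Lemma dist_path x p : path (@adj G) x p -> dist x (last x p) <= size p.
Proof.
(* For a walk with at least [#|G|] steps the default value is already a sufficient bound. *)
move=> xp; have [ltp|/(leq_trans (dist_le_card _ _))//] := ltnP (size p) #|G|.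
have := leqnn (dist x (last x p)); rewrite {2}/dist leq_bigminn => /andP[_].
move/forall_inP/(_ (Ordinal ltp)); apply.
by apply/existsP; exists (in_tuple p); rewrite xp /=.
Qed.

Lemma dist_geodesic x y : connect (@adj G) x y ->
  exists p, [/\ path (@adj G) x p, last x p = y & size p = dist x y].
Proof.
case/connectP=> p0 /shortenP[p xp up _] ->.
(* A walk without repeated vertices has fewer than [#|G|] steps, so the minimum is not the default
   value. *)
have ltp : size p < #|G| by rewrite -ltnS -[(size p).+1](card_uniqP up) ltnS max_card.
have : dist x (last x p) < #|G| by rewrite (leq_ltn_trans (dist_path xp)).
set y' := last x p; rewrite /dist.
(* The property carried through the minimum: a value below [#|G|] is the length of a walk from x to
   y'. The default satisfies it vacuously. *)
elim/big_ind: _ => [|m n hm hn|[n ltn] /= /existsP[q /andP[xq /eqP yq]] _].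
- by rewrite ltnn.
- by rewrite /minn; case: ifP.
- by exists q; rewrite size_tuple.
Qed.

Lemma dist0 x : dist x x = 0.
Proof. by apply/eqP; rewrite -leqn0; have := @dist_path x [::] isT. Qed.

Lemma dist_adj_le x y : adj x y -> dist x y <= 1.
Proof. by move=> xy; have := @dist_path x [:: y]; rewrite /= xy; apply. Qed.

Lemma adj_neq x y : adj x y -> x != y.
Proof. by apply: contraTneq => ->; rewrite adj_irr. Qed.

Hypothesis G_conn : connected G.

Lemma connected_connect x y : connect (@adj G) x y.
Proof. by case/andP: G_conn => _ /forallP/(_ x)/forallP/(_ y). Qed.

Lemma dist_sym x y : dist x y = dist y x.
Proof.
suff le (a b : G) : dist a b <= dist b a by apply/eqP; rewrite eqn_leq !le.
have [p [bp <- <-]] := dist_geodesic (connected_connect b a).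
have := @dist_path (last b p) (rev (belast b p)).
rewrite rev_path size_rev size_belast.
have -> : last (last b p) (rev (belast b p)) = b.
  by case: {bp} p => //= c p; rewrite rev_cons last_rcons.
by apply; rewrite (eq_path (e' := @adj G)) // => c d; rewrite /= adj_sym.
Qed.

Lemma dist_triangle x y z : dist x z <= dist x y + dist y z.
Proof.
have [p [xp <- <-]] := dist_geodesic (connected_connect x y).
have [q [yq <- <-]] := dist_geodesic (connected_connect (last x p) z).
by rewrite -size_cat -last_cat dist_path // cat_path xp.
Qed.

Lemma dist_eq0 x y : (dist x y == 0) = (x == y).
Proof.
apply/eqP/eqP => [|->]; last exact: dist0.
by have [[|? ?] [? <- <-]] := dist_geodesic (connected_connect x y).
Qed.

Lemma dist_adj x y : adj x y -> dist x y = 1.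
Proof.
move=> xy; have := dist_adj_le xy; have := dist_eq0 x y.
by rewrite (negPf (adj_neq xy)); lia.
Qed.

Lemma dist_edge2 u x y : dist_edge u [set x; y] = minn (dist u x) (dist u y).
Proof.
suff h m : (m <= dist_edge u [set x; y]) = (m <= minn (dist u x) (dist u y)).
  by apply/eqP; rewrite eqn_leq -h leqnn h leqnn.
rewrite leq_bigminn leq_min; apply/andP/andP => [[_ /forall_inP h]|[hx hy]].
  by rewrite !h // !inE eqxx ?orbT.
split; first exact: leq_trans hx (dist_le_card _ _).
by apply/forall_inP=> z /set2P[]->.
Qed.

End Distance.

(** * Edges, and edge sets closed under [Theta] *)

Section EdgeSets.
Variable G : sgraph.

Lemma edgesP (f : {set G}) :
  reflect (exists x y, adj x y /\ f = [set x; y]) (f \in edges G).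
Proof.
rewrite inE; apply: (iffP existsP) => [[x /existsP[y /andP[xy /eqP]]]|[x [y [xy ->]]]].
  by exists x, y.
by exists x; apply/existsP; exists y; rewrite xy eqxx.
Qed.

Lemma edge_other (f : {set G}) u : f \in edges G -> u \in f ->
  exists2 v, adj u v & f = [set u; v].
Proof.
case/edgesP=> x [y [xy ->]] /set2P[]->; first by exists y.
by exists x; rewrite 1?adj_sym // setUC.
Qed.

Lemma set2D1 (T : finType) (u v : T) : u != v -> [set u; v] :\ u = [set v].
Proof. by move=> uv; rewrite setU1K // inE. Qed.

Lemma in_closer_vertices (u v x : G) : u != v ->
  (x \in closer_vertices u [set u; v]) = (dist u x < dist v x).
Proof.
move=> uv; rewrite inE set2D1 //; apply/forall_inP/idP => [|h w /set1P-> //].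
by apply; rewrite inE.
Qed.

Lemma in_closer_edges (u v : G) f : u != v ->
  (f \in closer_edges u [set u; v]) =
  (f \in edges G) && (dist_edge u f < dist_edge v f).
Proof.
move=> uv; rewrite inE set2D1 //; congr (_ && _).
by apply/forall_inP/idP => [|h w /set1P-> //]; apply; rewrite inE.
Qed.

(** Contrapositive form of closure under [Theta]: an edge in F and an edge outside F are never
    related. This form is symmetric in F and its complement. *)
Definition theta_closed (F : {set {set G}}) := forall a b c d : G,
  adj a b -> adj c d -> ([set a; b] \in F) != ([set c; d] \in F) ->
  dist a c + dist b d = dist a d + dist b c.

Lemma theta_closedC (F : {set {set G}}) : theta_closed F -> theta_closed (~: F).
Proof. by move=> hF a b c d ab cd; rewrite !inE (inj_eq negb_inj); apply: hF. Qed.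

Lemma c_partition_closed (P : {set {set {set G}}}) F :
  connected G -> c_partition P -> F \in P -> theta_closed F.
Proof.
move=> G_conn /andP[_ /forall_inP hP] /hP /existsP[C /andP[/subsetP sC /eqP defF]].
have closed f g : f \in F -> Theta f g -> g \in F.
  rewrite defF => /bigcupP[B BC fB] fg; apply/bigcupP; exists B => //.
  case/imsetP: (sC _ BC) fB => h _ ->; rewrite !inE => /andP[_ hf].
  by rewrite (connect_trans hf (connect1 fg)) andbT; case/and3P: fg; rewrite !inE.
have half (a b c d : G) : adj a b -> adj c d -> [set a; b] \in F -> [set c; d] \notin F ->
    dist a c + dist b d = dist a d + dist b c.
  move=> ab cd abF; apply: contraNeq => neq; apply: closed abF _.
  apply/and3P; split; [by apply/edgesP; exists a, b | by apply/edgesP; exists c, d|].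
  apply/existsP; exists a; apply/existsP; exists b; apply/existsP; exists c.
  by apply/existsP; exists d; rewrite !eqxx (dist_sym G_conn c b).
move=> a b c d ab cd.
have [abF|abF] := boolP (_ \in F); have [cdF|cdF] := boolP (_ \in F) => // _.
  exact: half.
(* Here cd is the edge in F, so the two edges exchange roles and the symmetry of [dist] restores the
   order. *)
have := half _ _ _ _ cd ab cdF abF.
by rewrite !(dist_sym G_conn c) !(dist_sym G_conn d); lia.
Qed.

End EdgeSets.

(** * Geodesics minimise the number of F-edges *)

Section FCount.
Variables (G : sgraph) (F : {set {set G}}).
Hypotheses (G_conn : connected G) (F_closed : theta_closed F).
Implicit Types (x y z : G) (p q : seq G).

Fixpoint count_edges x p : nat :=
  if p is y :: p' then ([set x; y] \in F) + count_edges y p' else 0.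

Lemma count_edges_cat x p q :
  count_edges x (p ++ q) = count_edges x p + count_edges (last x p) q.
Proof. by elim: p x => //= y p IH x; rewrite IH addnA. Qed.

Local Open Scope ring_scope.

Fixpoint edge_potential x p z : int :=
  if p is y :: p' then
    ((dist z x)%:Z - (dist z y)%:Z) *+ ([set x; y] \in F) + edge_potential y p' z
  else 0.

(** No step in F is related by [Theta] to an edge outside F, so each term of the potential agrees at
    c and d. *)
Lemma edge_potential_off x p c d : path (@adj G) x p -> adj c d ->
  [set c; d] \notin F -> edge_potential x p c = edge_potential x p d.
Proof.
move=> + cd cdF; elim: p x => //= y p IH x /andP[xy /IH->]; congr (_ + _).
have := F_closed cd xy; rewrite (negPf cdF); case: (_ \in F) => [/(_ isT)|//].
by rewrite !GRing.mulr1n; lia.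
Qed.

(* As cd is in F, the steps of p outside F contribute nothing to the left-hand
   side, which is therefore a telescoping sum over all the steps of p. *)
Lemma edge_potential_on x p c d : path (@adj G) x p -> adj c d -> [set c; d] \in F ->
  edge_potential x p d - edge_potential x p c =
  (dist d x)%:Z - (dist d (last x p))%:Z - ((dist c x)%:Z - (dist c (last x p))%:Z).
Proof.
move=> + cd cdF; elim: p x => [|y p IH] x /=; first by lia.
case/andP=> xy /IH IHp; have := F_closed cd xy; rewrite cdF.
by case: (_ \in F) => [_|/(_ isT)]; rewrite ?GRing.mulr1n ?GRing.mulr0n; lia.
Qed.

(** Along an edge of F the rise is a difference of two changes of distance, each at most 1 in
    absolute value; hence the factor 2. *)
Lemma edge_potential_walk x p z q : path (@adj G) x p -> path (@adj G) z q ->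
  edge_potential x p (last z q) - edge_potential x p z <= (2 * count_edges z q)%N%:Z.
Proof.
move=> xp; elim: q z => [|c q IH] z /=; first by lia.
case/andP=> zc /IH {IH}; have [zcF|zcF] := boolP (_ \in F); last first.
  by rewrite (edge_potential_off xp zc zcF); lia.
have := edge_potential_on xp zc zcF.
have := dist_triangle G_conn c z x.
have := dist_triangle G_conn z c (last x p).
rewrite (dist_sym G_conn c z) (dist_adj G_conn zc); lia.
Qed.

(** Each F-step of the walk contributes 1 at the end and -1 at [x0]. The fixed vertex [x0], from
    which the walk leads away geodesically, lets the induction drop first steps. *)
Lemma edge_potential_geodesic x0 x p : path (@adj G) x p ->
  (dist x0 (last x p) = dist x0 x + size p)%N ->
  edge_potential x p (last x p) - edge_potential x p x0 = (2 * count_edges x p)%N%:Z.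
Proof.
elim: p x => [|y p IH] x /=; first by lia.
case/andP=> xy yp geo.
have := dist_triangle G_conn x0 y (last y p).
have := dist_triangle G_conn x0 x y.
have := dist_triangle G_conn x0 x (last y p).
have := dist_triangle G_conn x y (last y p).
have := dist_path yp; rewrite (dist_adj G_conn xy).
rewrite !(dist_sym G_conn (last y p)) => h1 h2 h3 h4 h5.
(* The triangle inequalities are tight here, so the tail again leads away geodesically from [x0]. *)
have h : (dist x0 (last y p) = dist x0 y + size p)%N by lia.
have {IH} := IH _ yp h.
by case: (_ \in F); rewrite ?GRing.mulr1n ?GRing.mulr0n; lia.
Qed.

Lemma geodesic_count_le x p q : path (@adj G) x p -> path (@adj G) x q ->
  last x q = last x p -> size p = dist x (last x p) ->
  (count_edges x p <= count_edges x q)%N.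
Proof.
move=> xp xq eqpq geo.
(* The potential of the geodesic p is evaluated along both p and q, which have the same ends. *)
have := edge_potential_geodesic (x0 := x) xp; rewrite dist0 -geo => /(_ erefl).
have := edge_potential_walk xp xq; rewrite eqpq; lia.
Qed.

End FCount.

(** * Projection of G onto G/F *)

Section Projection.
Variables (G : sgraph) (F : {set {set G}}).
Hypotheses (G_conn : connected G) (F_closed : theta_closed F).
Implicit Types (x y z : G) (X Y : quot F) (p q : seq G).

Lemma del_connect_sym : connect_sym (del_adj F).
Proof. by apply: sym_connect_sym => x y; rewrite /del_adj adj_sym setUC. Qed.

Lemma component_subproof x :
  [set y in [set: G] | connect (del_adj F) x y] \in components F.
Proof. exact: imset_f. Qed.

Definition proj x : quot F :=
  exist (fun A : {set G} => A \in components F) _ (component_subproof x).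

Lemma mem_proj x X : (x \in val X) = (proj x == X).
Proof.
rewrite -val_eqE /=; case/imsetP: (valP X) => z _ ->.
rewrite !inE /=; apply/idP/eqP => [zx|/setP/(_ x)]; last by rewrite !inE connect0.
by apply/setP=> y; rewrite !inE /= (same_connect del_connect_sym zx).
Qed.

Lemma proj_eq x y : (proj x == proj y) = connect (del_adj F) x y.
Proof. by rewrite eq_sym -mem_proj !inE. Qed.

Lemma proj_surj X : exists x, proj x = X.
Proof.
have := valP X => /imsetP[z _ defX]; exists z; apply/eqP.
by rewrite -mem_proj defX !inE connect0.
Qed.

Lemma del_path_walk x p :
  path (del_adj F) x p -> path (@adj G) x p /\ count_edges F x p = 0.
Proof.
by elim: p x => //= y p IH x /andP[/andP[-> /negPf->] /IH[-> ->]].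
Qed.

(** An edge of F is a geodesic with one F-edge; a walk in G \ F between its ends would have none,
    against minimality. *)
Lemma proj_edge x y : adj x y -> (proj x != proj y) = ([set x; y] \in F).
Proof.
move=> xy; have [xyF|xyF] := boolP (_ \in F); last first.
  by rewrite proj_eq connect1 // /del_adj xy xyF.
rewrite proj_eq; apply/negP => /connectP[p /del_path_walk[xp p0] lastp].
have := @geodesic_count_le G F G_conn F_closed x [:: y] p.
by rewrite /= xy xyF (dist_adj G_conn xy) p0 -lastp => /(_ isT xp erefl erefl).
Qed.

Lemma quot_adj_proj x y : adj x y -> adj (proj x) (proj y) = ([set x; y] \in F).
Proof.
move=> xy; rewrite -proj_edge //= /quot_adj.
apply: andb_idr => _; apply/exists_inP; exists x; first by rewrite mem_proj.
by apply/exists_inP; exists y; first by rewrite mem_proj.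
Qed.

(** Steps outside F collapse to a vertex, and steps in F become edges of G/F. *)
Lemma walk_proj x p : path (@adj G) x p ->
  exists q : seq (quot F), [/\ path (@adj (quot F)) (proj x) q,
    last (proj x) q = proj (last x p) & size q = count_edges F x p].
Proof.
elim: p x => [|y p IH] x; first by exists [::].
rewrite [count_edges _ _ _]/=; case/andP=> xy /IH[q [yq lastq sizeq]].
have := quot_adj_proj xy; have := proj_edge xy.
case: (_ \in F) => [_ xyq|/negbFE/eqP eqxy _].
  by exists (proj y :: q); split; rewrite ?[size _]/= ?sizeq //; apply/andP.
by exists q; rewrite [last x _]/= eqxy sizeq.
Qed.

(** Moving inside a component uses no F-edge, so a lift needs at most one F-edge for each edge of
    the quotient walk. *)
Lemma walk_lift x y (q : seq (quot F)) :
  path (@adj (quot F)) (proj x) q -> last (proj x) q = proj y ->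
  exists p, [/\ path (@adj G) x p, last x p = y & count_edges F x p <= size q].
Proof.
elim: q x => [|Z q IH] x.
  move=> _ /eqP; rewrite /= proj_eq => /connectP[p /del_path_walk[xp p0] lastp].
  by exists p; rewrite p0.
case/andP=> /andP[_ /exists_inP[a ax /exists_inP[b + ab]]] + lastq.
rewrite mem_proj => /eqP defZ; subst Z => bq.
have [p [bp lastp sizep]] := IH _ bq lastq.
move: ax; rewrite mem_proj eq_sym proj_eq => /connectP[p' /del_path_walk[xp p0] lasta].
exists (p' ++ b :: p); rewrite cat_path last_cat count_edges_cat -lasta p0 /= xp ab.
by split=> //; case: (_ \in F); rewrite /= ?add1n ?add0n ?ltnS // leqW.
Qed.

Lemma quot_connect X Y : connect (@adj (quot F)) X Y.
Proof.
have [[x <-] [y <-]] := (proj_surj X, proj_surj Y).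
have /connectP[p /walk_proj[q [xq lastq _]] ->] := connected_connect G_conn x y.
by apply/connectP; exists q.
Qed.

(** Projecting the geodesic gives one inequality. For the other, a shortest walk in G/F is lifted
    and compared with the geodesic by minimality. *)
Lemma dist_quot x p : path (@adj G) x p -> size p = dist x (last x p) ->
  dist (proj x) (proj (last x p)) = count_edges F x p.
Proof.
move=> xp geo; apply/eqP; rewrite eqn_leq; apply/andP; split.
  by have [q [xq <- <-]] := walk_proj xp; apply: dist_path.
have [q [xq lastq <-]] := dist_geodesic (quot_connect (proj x) (proj (last x p))).
have [p' [xp' lastp' le]] := walk_lift xq lastq; apply: leq_trans le.
exact: geodesic_count_le.
Qed.

End Projection.

(** * Splitting of distances, and closeness read off G/F *)

Lemma count_edgesC (G : sgraph) (F : {set {set G}}) x p :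
  count_edges F x p + count_edges (~: F) x p = size p.
Proof.
elim: p x => //= y p IH x; rewrite inE addnACA IH.
by case: (_ \in F).
Qed.

Section Transfer.
Variables (G : sgraph) (F : {set {set G}}).
Hypotheses (G_conn : connected G) (F_closed : theta_closed F).
Hypothesis (F_edges : F \subset edges G).
Implicit Types (x y z u v : G) (f g : {set G}).

Let FC_closed := theta_closedC F_closed.

Lemma dist_split x y : dist x y =
  dist (proj F x) (proj F y) + dist (proj (~: F) x) (proj (~: F) y).
Proof.
have [p [xp <- geo]] := dist_geodesic (connected_connect G_conn x y).
by rewrite !dist_quot // count_edgesC.
Qed.

Lemma projC_eq x y : adj x y -> [set x; y] \in F -> proj (~: F) x = proj (~: F) y.
Proof.
move=> xy xyF; apply/eqP/negbFE.
by rewrite (proj_edge G_conn FC_closed xy) inE xyF.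
Qed.

Lemma proj_eq_off x y : adj x y -> [set x; y] \notin F -> proj F x = proj F y.
Proof. by move=> xy xyF; apply/eqP/negbFE; rewrite proj_edge // (negPf xyF). Qed.

(** The ends of f have the same image under [proj (~: F)], so the second summands in [dist_split]
    cancel. *)
Lemma closer_vertices_proj u f x : f \in F -> u \in f ->
  (x \in closer_vertices u f) =
  (proj F x \in closer_vertices (proj F u) (proj F @: f)).
Proof.
move=> fF uf; have [v uv deff] := edge_other (subsetP F_edges _ fF) uf; subst f.
rewrite imsetU1 imset_set1 !in_closer_vertices ?(adj_neq uv) ?proj_edge //.
rewrite (dist_split u) (dist_split v) (projC_eq uv fF); lia.
Qed.

(** The ends of g also coincide under [proj (~: F)], so both distances to g exceed those in G/F by
    the same constant. *)
Lemma closer_edges_on u f g : f \in F -> u \in f -> g \in F ->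
  (g \in closer_edges u f) =
  (proj F @: g \in closer_edges (proj F u) (proj F @: f)).
Proof.
move=> fF uf gF; have [v uv deff] := edge_other (subsetP F_edges _ fF) uf; subst f.
have /edgesP[x [y [xy defg]]] := subsetP F_edges _ gF; subst g.
rewrite !imsetU1 !imset_set1 !in_closer_edges ?(adj_neq uv) ?proj_edge //.
rewrite (subsetP F_edges) //= !dist_edge2.
have -> /= : [set proj F x; proj F y] \in edges (quot F).
  by apply/edgesP; exists (proj F x), (proj F y); rewrite quot_adj_proj.
rewrite !(dist_split u) !(dist_split v) (projC_eq uv fF) (projC_eq xy gF); lia.
Qed.

(** An edge outside F collapses to a vertex of G/F; the remaining minimum, taken in the other
    quotient, is common to both ends of f. *)
Lemma closer_edges_off u f x y : f \in F -> u \in f -> adj x y -> [set x; y] \notin F ->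
  ([set x; y] \in closer_edges u f) =
  (proj F x \in closer_vertices (proj F u) (proj F @: f)).
Proof.
move=> fF uf xy xyF; have [v uv deff] := edge_other (subsetP F_edges _ fF) uf; subst f.
rewrite imsetU1 imset_set1 in_closer_edges ?in_closer_vertices ?(adj_neq uv) ?proj_edge //.
have -> /= : [set x; y] \in edges G by apply/edgesP; exists x, y.
rewrite !dist_edge2 !(dist_split u) !(dist_split v) (projC_eq uv fF).
rewrite (proj_eq_off xy xyF); lia.
Qed.

(** * Fibres of the projection and the weighted sums *)

Lemma mem_quot_hat (E : {set quot F}) f : E \in edges (quot F) ->
  (f \in quot_hat E) = (f \in F) && (proj F @: f == E).
Proof.
case/edgesP=> X [Y [/andP[XY _] ->]]; rewrite inE; apply/idP/andP.
  case/existsP=> X' /existsP[Y' /andP[/eqP eqE]].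
  case/exists_inP=> x; rewrite mem_proj => /eqP defX'.
  case/exists_inP=> y; rewrite mem_proj => /eqP defY' /andP[xy /eqP->].
  rewrite -proj_edge // imsetU1 imset_set1 defX' defY' eqE; split=> //.
  (* If X' and Y' were equal, E would be a singleton, whereas X and Y are distinct. *)
  apply: contraNneq XY => eqXY; move: eqE; rewrite eqXY setUid => eqE.
  have: X \in [set Y'] by rewrite -eqE !inE eqxx.
  have: Y \in [set Y'] by rewrite -eqE !inE eqxx orbT.
  by move=> /set1P-> /set1P->.
case=> fF /eqP eqf; have /edgesP[x [y [xy deff]]] := subsetP F_edges _ fF; subst f.
apply/existsP; exists (proj F x); apply/existsP; exists (proj F y).
rewrite -eqf imsetU1 imset_set1 eqxx andTb.
apply/exists_inP; exists x; first by rewrite mem_proj.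
by apply/exists_inP; exists y; rewrite ?mem_proj // xy eqxx.
Qed.

Lemma proj_edges f : f \in F -> proj F @: f \in edges (quot F).
Proof.
move=> fF; have /edgesP[x [y [xy deff]]] := subsetP F_edges _ fF; subst f.
apply/edgesP; exists (proj F x), (proj F y).
by rewrite quot_adj_proj // imsetU1 imset_set1.
Qed.

(** This allows sums and products over the ends of the image edge to be reindexed by the ends of
    f. *)
Lemma proj_inj_edge f : f \in F -> {in f &, injective (proj F)}.
Proof.
move=> fF; have /edgesP[x [y [xy deff]]] := subsetP F_edges _ fF; subst f.
move: fF; rewrite -proj_edge // => /negPf neq.
by move=> a b /set2P[]-> /set2P[]-> // /eqP; rewrite 1?[_ == proj F x]eq_sym neq.
Qed.

Lemma sum_quot_w' (b : {set quot F} -> nat) :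
  \sum_(E in edges (quot F)) quot_w' E * b E =
  \sum_(f in F) deg_edge f * b (proj F @: f).
Proof.
rewrite (partition_big (fun f => proj F @: f) (mem (edges (quot F)))) /=; last first.
  exact: proj_edges.
apply: eq_bigr => E E_edge; rewrite big_distrl /=.
by apply: eq_big => [f|f]; rewrite mem_quot_hat // => /andP[_ /eqP->].
Qed.

Lemma n_wt_quot u f : f \in F -> u \in f ->
  n_wt (@quot_w G F) (proj F u) (proj F @: f) = n_ u f.
Proof.
move=> fF uf; rewrite /n_ -sum1_card.
rewrite (partition_big (proj F) (mem (closer_vertices (proj F u) (proj F @: f)))) /=.
  apply: eq_bigr => X X_closer; rewrite /quot_w -sum1_card; apply: eq_bigl => x.
  rewrite mem_proj closer_vertices_proj //; case: eqP => [->|]; rewrite ?andbF //.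
  by rewrite X_closer.
by move=> x; rewrite closer_vertices_proj.
Qed.

(** The edges closer to u are split by membership in F: those in F are grouped by their image edge,
    the others by the component that contains them. *)
Lemma m_wt_quot u f : f \in F -> u \in f ->
  n_wt (@quot_lam G F) (proj F u) (proj F @: f) +
  m_wt (@quot_lam' G F) (proj F u) (proj F @: f) = m_ u f.
Proof.
move=> fF uf; rewrite /m_ -(cardsID F) addnC; congr (_ + _).
  rewrite -sum1_card.
  rewrite (partition_big (fun g => proj F @: g)
    (mem (closer_edges (proj F u) (proj F @: f)))) /=; last first.
    by move=> g /setIP[+ gF]; rewrite closer_edges_on.
  apply: eq_bigr => E E_closer; rewrite /quot_lam' -sum1_card.
  apply: eq_bigl => g; rewrite mem_quot_hat; last by move: E_closer; rewrite inE => /andP[].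
  rewrite inE; have [gF|] := boolP (g \in F); rewrite ?andbF //= andbT.
  by rewrite closer_edges_on //; case: eqP => [->|]; rewrite ?E_closer ?andbF.
rewrite /n_wt; under eq_bigr do rewrite /quot_lam -sum1_card.
rewrite (exchange_big_dep (mem (edges G :\: F))) /=; last first.
  by move=> X g _; rewrite inE => /andP[].
transitivity (\sum_(g in edges G :\: F) (g \in closer_edges u f : nat)).
  apply: eq_bigr => g; rewrite inE => /andP[gF g_edge].
  case/edgesP: (g_edge) => x [y [xy defg]]; subst g.
  rewrite closer_edges_off //.
  (* The component of x is the only one containing both ends of the edge xy outside F. *)
  transitivity (\sum_(X | (X \in closer_vertices (proj F u) (proj F @: f)) &&
                           (X == proj F x)) 1); last first.
    by rewrite big_mkcondl big_pred1_eq; case: (_ \in _).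
  apply: eq_bigl => X; rewrite [_ \in [set _ in _ | _]]inE in_setD gF g_edge /=; congr (_ && _).
  by rewrite subUset !sub1set !mem_proj -(proj_eq_off xy gF) andbb eq_sym.
rewrite -sum1_card [RHS]big_mkcond /= [LHS]big_mkcond /=.
apply: eq_bigr => g _; rewrite !inE.
by case: (g \in F); case: [exists x, _]; case: [forall (v | _), _].
Qed.

Lemma prod_n_wt f : f \in F ->
  \prod_(U in proj F @: f) n_wt (@quot_w G F) U (proj F @: f) = \prod_(u in f) n_ u f.
Proof.
move=> fF; rewrite big_imset; last exact: proj_inj_edge.
by apply: eq_bigr => u uf; apply: n_wt_quot.
Qed.

Lemma sum_n_wt f : f \in F ->
  \sum_(U in proj F @: f) n_wt (@quot_w G F) U (proj F @: f) = \sum_(u in f) n_ u f.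
Proof.
move=> fF; rewrite big_imset; last exact: proj_inj_edge.
by apply: eq_bigr => u uf; apply: n_wt_quot.
Qed.

Lemma prod_m_wt f : f \in F ->
  \prod_(U in proj F @: f) (n_wt (@quot_lam G F) U (proj F @: f) +
                            m_wt (@quot_lam' G F) U (proj F @: f)) = \prod_(u in f) m_ u f.
Proof.
move=> fF; rewrite big_imset; last exact: proj_inj_edge.
by apply: eq_bigr => u uf; apply: m_wt_quot.
Qed.

Lemma sum_m_wt f : f \in F ->
  \sum_(U in proj F @: f) n_wt (@quot_lam G F) U (proj F @: f) +
  \sum_(U in proj F @: f) m_wt (@quot_lam' G F) U (proj F @: f) = \sum_(u in f) m_ u f.
Proof.
move=> fF; rewrite -big_split big_imset; last exact: proj_inj_edge.
by apply: eq_bigr => u uf; apply: m_wt_quot.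
Qed.

Lemma Sz_quot : Sz (@quot_w G F) (@quot_w' G F) =
  \sum_(f in F) deg_edge f * \prod_(u in f) n_ u f.
Proof. by rewrite /Sz sum_quot_w'; apply: eq_bigr => f fF; rewrite prod_n_wt. Qed.

Lemma PIv_quot : PIv (@quot_w G F) (@quot_w' G F) =
  \sum_(f in F) deg_edge f * \sum_(u in f) n_ u f.
Proof. by rewrite /PIv sum_quot_w'; apply: eq_bigr => f fF; rewrite sum_n_wt. Qed.

Lemma Szt_quot : Szt (@quot_lam G F) (@quot_lam' G F) (@quot_w' G F) =
  \sum_(f in F) deg_edge f * \prod_(u in f) m_ u f.
Proof. by rewrite /Szt sum_quot_w'; apply: eq_bigr => f fF; rewrite prod_m_wt. Qed.

Lemma PIv_PI_quot :
  PIv (@quot_lam G F) (@quot_w' G F) + PI (@quot_lam' G F) (@quot_w' G F) =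
  \sum_(f in F) deg_edge f * \sum_(u in f) m_ u f.
Proof.
rewrite /PIv /PI !sum_quot_w' -big_split; apply: eq_bigr => f fF /=.
by rewrite -mulnDr sum_m_wt.
Qed.

End Transfer.

Theorem theorem6p1 (G : sgraph) (k : nat) (F : 'I_k -> {set {set G}})
  (G_connected : connected G)
  (F_inj : injective F)
  (F_cpart : c_partition [set F i | i : 'I_k]) :
  [/\ wSz_star G = \sum_(i < k) Sz (@quot_w G (F i)) (@quot_w' G (F i)),
      wPIv_star G = \sum_(i < k) PIv (@quot_w G (F i)) (@quot_w' G (F i)),
      wSze_star G =
        \sum_(i < k) Szt (@quot_lam G (F i)) (@quot_lam' G (F i)) (@quot_w' G (F i))
    & wPI_star G =
        \sum_(i < k) (PIv (@quot_lam G (F i)) (@quot_w' G (F i)) +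
                      PI (@quot_lam' G (F i)) (@quot_w' G (F i)))].
Proof.
have F_part : partition [set F i | i : 'I_k] (edges G) by case/andP: F_cpart.
have F_mem i : F i \in [set F i | i : 'I_k] by apply: imset_f.
have F_closed i : theta_closed (F i) by apply: c_partition_closed (F_mem i).
have F_edges i : F i \subset edges G.
  by rewrite -(cover_partition F_part) bigcup_sup.
(* Injectivity of F turns the sum over the set of parts into a sum over indices. *)
have sum_parts (h : {set G} -> nat) :
    \sum_(e in edges G) h e = \sum_(i < k) \sum_(e in F i) h e.
  by rewrite (set_partition_big _ F_part) /= big_imset //; apply: in2W.
split; rewrite /wSz_star /wPIv_star /wSze_star /wPI_star sum_parts;
  apply: eq_bigr => i _.
- by rewrite Sz_quot.
- by rewrite PIv_quot.
- by rewrite Szt_quot.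
- by rewrite PIv_PI_quot.
Qed.
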